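(* Let $n\ge d\ge 1$ be integers and let $r(t)=(r_1(t),\dots,r_d(t))$ be differentiable in $t$ with $r_1(t)>\dots>r_d(t)>0$. The equations $$\dot r_k(t)=\sum_{j\colon j\ne k}\left(\frac{1}{r_k(t)-r_j(t)}+\frac{1}{r_k(t)+r_j(t)}\right)+\frac{n+1}{r_k(t)},\qquad k=1,\dots,d,$$ are equivalent to the vector equality $\dot r=\nabla H(r)$, where $\nabla$ is the gradient with respect to $(r_1,\dots,r_d)$ and $$H(r)=\log\left[\left(\prod_{i=1}^d r_i^{\,n+1}\right)\prod_{1\le i<j\le d}(r_i-r_j)(r_i+r_j)\right].$$
   Context: A dot denotes the derivative with respect to $t$. Sums over $j$ range over $j\in\{1,\dots,d\}\setminus\{k\}$. *)

(* Defs.v *)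
From HB Require Import structures.
From mathcomp Require Import all_boot all_order all_algebra.
From mathcomp Require Import all_classical all_reals all_analysis.
Set Implicit Arguments.
Unset Strict Implicit.
Unset Printing Implicit Defensive.
Import Order.TTheory GRing.Theory Num.Theory.
Import numFieldNormedType.Exports.
Local Open Scope classical_set_scope.
Local Open Scope ring_scope.

(* The index k in {1, ..., d} is shifted to 'I_d = {0, ..., d-1}. *)

Definition weyl_chamberB (R : realType) (d : nat) : set 'rV[R]_d :=
  [set x | (forall i j : 'I_d, (i < j)%N -> x 0 j < x 0 i) /\
           (forall i : 'I_d, 0 < x 0 i)].

(* The partial derivatives are total: 'D_v f x is only meaningful when f is
   derivable at x along v. This is the case for [potentialH] on the open set
   [weyl_chamberB], where the argument of [ln] is positive. *)
Definition gradient (R : realType) (d : nat) (f : 'rV[R]_d -> R)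
    (x : 'rV[R]_d) : 'rV[R]_d :=
  \row_(k < d) 'D_(delta_mx 0 k) f x.

Definition potentialH (R : realType) (n d : nat) (x : 'rV[R]_d) : R :=
  ln ((\prod_(i < d) x 0 i ^+ n.+1) *
      \prod_(i < d) \prod_(j < d | (i < j)%N)
        ((x 0 i - x 0 j) * (x 0 i + x 0 j))).

(* Main.v *)
Require Import Defs.
From HB Require Import structures.
From mathcomp Require Import all_boot all_order all_algebra.
From mathcomp Require Import all_classical all_reals all_analysis.
From mathcomp Require Import ring.
Set Implicit Arguments.
Unset Strict Implicit.
Import Order.TTheory GRing.Theory Num.Theory.
Import numFieldNormedType.Exports.
Local Open Scope classical_set_scope.
Local Open Scope ring_scope.

(** The derivative of a curve in a space of row vectors is taken coordinatewise
    ([derive_mx]), so the vector equality is the system of its coordinates, and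
    everything reduces to computing the partial derivatives of the potential in
    the Weyl chamber ([gradient_potentialH]).

    The potential is the logarithm of a product of linear forms, all positive in
    the chamber. Logarithmic derivatives turn products into sums
    ([is_logderive_prod]), so its k-th partial derivative is the sum, over the
    factors, of the logarithmic derivatives of the factors in the direction k.
    The factors x_i contribute (n + 1) / x_k. A pair i < j contributes
    ('d_ik - 'd_jk) / (x_i - x_j) + ('d_ik + 'd_jk) / (x_i + x_j), with
    Kronecker symbols; this is symmetric in i and j and vanishes unless one of
    them is k, so the sum over ordered pairs collapses to a sum over the
    j different from k ([sum_pairs_through]). *)

(** Restricting to a line makes the one-variable chain rule available for
    directional derivatives. *)
Lemma is_derive_lineP (R : numFieldType) (V W : normedModType R) (f : V -> W)
    (x v : V) (l : W) :
  is_derive x v f l <-> is_derive (0 : R) 1 (fun h : R => f (h *: v + x)) l.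
Proof.
have deriveE : 'D_1 (fun h : R => f (h *: v + x)) 0 = 'D_v f x.
  rewrite /derive; set g1 := fun h => _; set g2 := fun h => _.
  suff -> : g1 = g2 by [].
  by apply/funext => h; rewrite /g1 /g2 /= addr0 scale0r add0r [h%:A]mulr1.
split=> -[df dE]; apply: DeriveDef; rewrite -?dE //.
  exact: (derivable1P f x v).1.
exact: (derivable1P f x v).2.
Qed.

Lemma is_derive_comp1 (R : realType) (V : normedModType R) (f : R -> R)
    (g : V -> R) (x v : V) (a b : R) :
  is_derive (g x) 1 f a -> is_derive x v g b -> is_derive x v (f \o g) (a * b).
Proof.
move=> df /is_derive_lineP dg; apply/is_derive_lineP.
by apply: is_derive1_comp; rewrite /= scale0r add0r.
Qed.

(** Stated without a division, so that the product rule holds even where a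
    factor vanishes. *)
Definition is_logderive (R : numFieldType) (V : normedModType R) (x v : V)
    (f : V -> R) (l : R) : Prop :=
  is_derive x v f (f x * l).

Lemma is_logderiveM (R : numFieldType) (V : normedModType R) (x v : V)
    (f g : V -> R) (l m : R) :
  is_logderive x v f l -> is_logderive x v g m ->
  is_logderive x v (fun y => f y * g y) (l + m).
Proof.
move=> df dg; apply: is_derive_eq (is_deriveM df dg) _.
by rewrite /GRing.scale /=; ring.
Qed.

Lemma is_logderive_prod (R : numFieldType) (V : normedModType R) (x v : V)
    (I : Type) (s : seq I) (P : pred I) (f : I -> V -> R) (l : I -> R) :
  (forall i, P i -> is_logderive x v (f i) (l i)) ->
  is_logderive x v (fun y => \prod_(i <- s | P i) f i y) (\sum_(i <- s | P i) l i).
Proof.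
move=> df; elim: s => [|i s IHs].
  rewrite /is_logderive /= !big_nil mulr0.
  by under eq_fun do rewrite big_nil; exact: is_derive_cst.
rewrite big_cons; under eq_fun do rewrite big_cons.
by case: ifP => // Pi; apply: is_logderiveM => //; apply: df.
Qed.

Lemma is_logderiveX (R : numFieldType) (V : normedModType R) (x v : V)
    (f : V -> R) (l : R) (n : nat) :
  is_logderive x v f l -> is_logderive x v (fun y => f y ^+ n) (n%:R * l).
Proof.
move=> df; have -> : n%:R * l = \sum_(i < n) l.
  by rewrite sumr_const card_ord mulr_natl.
have -> : (fun y => f y ^+ n) = fun y => \prod_(i < n) f y.
  by apply/funext => y; rewrite prodr_const card_ord.
by apply: (@is_logderive_prod _ _ _ _ _ _ _ (fun=> f) (fun=> l)) => i _.
Qed.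

Lemma is_derive_ln_comp (R : realType) (V : normedModType R) (x v : V)
    (f : V -> R) (l : R) :
  0 < f x -> is_logderive x v f l -> is_derive x v (fun y => ln (f y)) l.
Proof.
move=> fx0 df.
apply: is_derive_eq (is_derive_comp1 (is_derive1_ln fx0) df) _.
by rewrite mulKf ?gt_eqF.
Qed.

Lemma is_derive_logderive (R : numFieldType) (V : normedModType R) (x v : V)
    (f : V -> R) (a : R) :
  f x != 0 -> is_derive x v f a -> is_logderive x v f (a / f x).
Proof. by move=> fx0 df; apply: is_derive_eq df _; rewrite mulrC divfK. Qed.

Lemma is_derive_coord (R : realType) (d : nat) (x v : 'rV[R]_d) (i : 'I_d) :
  is_derive x v (fun y : 'rV[R]_d => y 0 i) (v 0 i).
Proof.
have := @derivable_id R 'rV[R]_d x v.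
move=> /[dup] /derivable_mxP/(_ 0 i) dc /derive_mx.
rewrite derive_id => /rowP/(_ i); rewrite mxE => ->.
exact: DeriveDef.
Qed.

(** Each j different from k occurs in exactly one increasing pair with k, and
    the symmetry of [g] makes its position in that pair irrelevant. *)
Lemma sum_pairs_through (M : nmodType) (d : nat) (k : 'I_d)
    (g : 'I_d -> 'I_d -> M) :
  (forall i j, g i j = g j i) ->
  (forall i j, i != k -> j != k -> g i j = 0) ->
  \sum_(i < d) \sum_(j < d | (i < j)%N) g i j = \sum_(j < d | j != k) g k j.
Proof.
move=> gC g0; rewrite (bigD1 k) //= [RHS](bigID (fun j : 'I_d => (k < j)%N)) /=.
congr (_ + _).
  by apply: eq_bigl => j; rewrite andbC -val_eqE /=; case: ltngtP.
rewrite [RHS]big_mkcondr /=; apply: eq_bigr => i ik.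
(* Only j = k survives in the row of i, and it is present exactly when i < k. *)
have -> : \sum_(j < d | (i < j)%N) g i j
    = \sum_(j < d | j == k) (if (i < j)%N then g i j else 0).
  rewrite [LHS]big_mkcond (bigID (pred1 k)) /= [X in _ + X]big1 ?addr0 //.
  by move=> j jk; rewrite g0 // if_same.
rewrite big_pred1_eq gC; move: ik; rewrite -val_eqE /=.
by case: ltngtP.
Qed.

Lemma gradient_potentialH (R : realType) (n d : nat) (x : 'rV[R]_d) (k : 'I_d) :
  weyl_chamberB x ->
  gradient (@potentialH R n d) x 0 k =
    \sum_(j < d | j != k) (1 / (x 0 k - x 0 j) + 1 / (x 0 k + x 0 j))
    + (n%:R + 1) / x 0 k.
Proof.
move=> [xlt x0]; rewrite mxE.
pose v : 'rV[R]_d := delta_mx 0 k.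
pose g i j := (v 0 i - v 0 j) / (x 0 i - x 0 j)
            + (v 0 i + v 0 j) / (x 0 i + x 0 j).
have vE i : v 0 i = (i == k)%:R by rewrite mxE.
have xB (i j : 'I_d) : (i < j)%N -> 0 < x 0 i - x 0 j by move=> ij; rewrite subr_gt0 xlt.
have xD i j : 0 < x 0 i + x 0 j by rewrite addr_gt0.
have dH : is_derive x v (@potentialH R n d)
    ((\sum_(i < d) n.+1%:R * (v 0 i / x 0 i))
     + \sum_(i < d) \sum_(j < d | (i < j)%N) g i j).
  apply: is_derive_ln_comp.
    apply: mulr_gt0; apply: prodr_gt0 => i _; first exact: exprn_gt0.
    by apply: prodr_gt0 => j ij; rewrite mulr_gt0 ?xB ?xD.
  apply: is_logderiveM; apply: is_logderive_prod => i _.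
    apply: is_logderiveX; apply: is_derive_logderive; first by rewrite gt_eqF.
    exact: is_derive_coord.
  apply: is_logderive_prod => j ij.
  apply: is_logderiveM; apply: is_derive_logderive.
  - by rewrite gt_eqF ?xB.
  - exact: (is_deriveB (is_derive_coord _ _ _) (is_derive_coord _ _ _)).
  - by rewrite gt_eqF ?xD.
  - exact: (is_deriveD (is_derive_coord _ _ _) (is_derive_coord _ _ _)).
rewrite derive_val (sum_pairs_through (k := k)).
- rewrite addrC; congr (_ + _).
    by apply: eq_bigr => j jk; rewrite /g !vE eqxx (negbTE jk) subr0 addr0.
  rewrite (bigD1 k) //= big1 => [|i ik]; last by rewrite vE (negbTE ik) mul0r mulr0.
  by rewrite vE eqxx addr0 mulrA mulr1 natr1.
- move=> i j; rewrite /g; congr (_ + _).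
    by rewrite -(opprB (v 0 j)) -(opprB (x 0 j)) invrN mulrNN.
  by rewrite (addrC (v 0 j)) (addrC (x 0 j)).
- by move=> i j ik jk; rewrite /g !vE (negbTE ik) (negbTE jk) subr0 addr0 !mul0r addr0.
Qed.

Unset Implicit Arguments.
Set Strict Implicit.

Theorem proposition2p8 (R : realType) (n d : nat) (I : set R)
    (r : R -> 'rV[R]_d) :
  (1 <= d)%N -> (d <= n)%N ->
  (forall t, I t -> derivable r t 1) ->
  (forall t, I t -> weyl_chamberB (r t)) ->
  forall t, I t ->
    ((forall k : 'I_d,
        (fun s => r s 0 k)^`()%classic t =
          \sum_(j < d | j != k)
             (1 / (r t 0 k - r t 0 j) + 1 / (r t 0 k + r t 0 j))
          + (n%:R + 1) / r t 0 k)
     <-> r^`()%classic t = gradient (@potentialH R n d) (r t)).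
Proof.
move=> _ _ dr rW t It.
have dE k : (fun s => r s 0 k)^`()%classic t = r^`()%classic t 0 k.
  by rewrite !derive1E derive_mx ?mxE //; exact: dr.
split=> [req | req k].
  by apply/rowP => k; rewrite -dE req gradient_potentialH //; exact: rW.
by rewrite dE req gradient_potentialH //; exact: rW.
Qed.
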